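(* For each $n\ge1$ we have $$|\mathrm{Tree}_n|=|\mathrm{End}_n|\quad\text{and}\quad|\mathrm{Tree}^{\star}_n|=|\mathrm{Cay}_n|.$$
   Context: Write $[n]=\{1,\dots,n\}$. $\mathrm{End}_n$ is the set of endofunctions $x:[n]\to[n]$, and $\mathrm{Cay}_n$ (Cayley permutations of size $n$) is the set of those $x\in\mathrm{End}_n$ whose image is $[k]$ for some $k\le n$. A binary tree is either empty or a triple $T=(L,r,R)$ with $r$ a node (the root) and $L,R$ binary trees (left and right subtree). $V(T)$ is the set of nodes and the size of $T$ is $|V(T)|$. A vertex labeling is a map $\mathfrak{l}:V(T)\to\{1,2,\dots\}$; $\max(T)$ is the largest label, with $\max(\emptyset)=0$. Labeled binary trees are considered up to label-preserving isomorphism of binary trees. $T$ is decreasing if it is empty, or $T=(L,r,R)$ with $L,R$ decreasing and $\mathfrak{l}(r)\ge\max\{\max(L),\max(R)\}$. $T$ is strictly decreasing to the left if it is empty, or $T=(L,r,R)$ with $\mathfrak{l}(r)>\max(L)$ and $L,R$ strictly decreasing to the left. An endotree of size $n$ is a decreasing binary tree of size $n$ that is strictly decreasing to the left and has all labels in $[n]$; it is regular if the set of its labels equals $[k]$ for some $k\le n$. $\mathrm{Tree}_n$ is the set of endotrees of size $n$ and $\mathrm{Tree}^{\star}_n$ the set of regular endotrees of size $n$. *)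

(* Defs.v *)
From HB Require Import structures.
From mathcomp Require Import all_boot.
From mathcomp Require Import boolp classical_sets cardinality.

Set Implicit Arguments.
Unset Strict Implicit.
Unset Printing Implicit Defensive.

Local Open Scope classical_set_scope.

(* [Node L a R] is (L, r, R) with root r labeled a. Nodes carry no identity
   besides their position, so two labeled binary trees are isomorphic iff they
   are represented by the same term. Positivity of the labels is not built in:
   it is part of the condition that they lie in [n], in [endotree]. *)
Inductive lbtree : Type :=
| Empty
| Node of lbtree & nat & lbtree.

Fixpoint tsize (t : lbtree) : nat :=
  if t is Node l _ r then (tsize l + tsize r).+1 else 0.

Fixpoint labels (t : lbtree) : seq nat :=
  if t is Node l a r then labels l ++ a :: labels r else [::].

Definition tmax (t : lbtree) : nat := \max_(a <- labels t) a.

Fixpoint decreasing (t : lbtree) : bool :=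
  if t is Node l a r
  then [&& decreasing l, decreasing r & maxn (tmax l) (tmax r) <= a]
  else true.

Fixpoint left_strict (t : lbtree) : bool :=
  if t is Node l a r
  then [&& tmax l < a, left_strict l & left_strict r]
  else true.

Definition endotree (n : nat) (t : lbtree) : bool :=
  [&& tsize t == n, decreasing t, left_strict t
    & all (fun a => 1 <= a <= n) (labels t)].

Definition regular (n : nat) (t : lbtree) : Prop :=
  exists2 k : nat, k <= n & [set` labels t] = [set a | 1 <= a <= k].

Definition Tree (n : nat) : set lbtree := [set t | endotree n t].

Definition RegTree (n : nat) : set lbtree :=
  [set t | endotree n t /\ regular n t].

(* On the side of functions, i : 'I_n stands for the element i + 1 of [n], so
   that [k], for k <= n, is the set of the i : 'I_n such that i < k. *)
Definition End (n : nat) : set {ffun 'I_n -> 'I_n} := setT.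

Definition Cay (n : nat) : set {ffun 'I_n -> 'I_n} :=
  [set x : {ffun 'I_n -> 'I_n} |
    exists2 k : nat, k <= n & range x = [set i : 'I_n | i < k]].

Arguments End : clear implicits.
Arguments Cay : clear implicits.

(* Main.v *)
Require Import Defs.
From HB Require Import structures.
From mathcomp Require Import all_boot.
From mathcomp Require Import boolp classical_sets cardinality.

Set Implicit Arguments.
Unset Strict Implicit.
Unset Printing Implicit Defensive.

Local Open Scope classical_set_scope.
Local Open Scope card_scope.

(** Both tree conditions together say that the root of every subtree carries
    the leftmost maximum of the in-order reading of that subtree. Hence such a
    tree is determined by its in-order reading, and every word of positive
    letters is the reading of exactly one such tree: its max-Cartesian tree,
    built by inserting the letters one after the other along the right spine.
    Functions [n] -> [n] are the words of length n over [n], and a tree is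
    regular iff the set of letters of its reading is an initial interval. *)

(** The test is strict: only a letter above the root takes the tree as its left subtree, while a
    letter equal to the root goes to the right, where ties are allowed. *)
Fixpoint insert_right (t : lbtree) (a : nat) : lbtree :=
  if t is Node l b r then
    if b < a then Node t a Defs.Empty else Node l b (insert_right r a)
  else Node Defs.Empty a Defs.Empty.

Definition cartesian_tree (s : seq nat) : lbtree := foldl insert_right Defs.Empty s.

Definition left_max_tree (t : lbtree) : bool := decreasing t && left_strict t.

Lemma tmax_leqP (t : lbtree) (m : nat) :
  reflect {in labels t, forall a, a <= m} (tmax t <= m).
Proof.
apply: (iffP (bigmax_leqP_seq _ _ _ _)) => [H a at_ | H a at_ _]; exact: H.
Qed.

Lemma tmax_empty : tmax Defs.Empty = 0.
Proof. by rewrite /tmax /= big_nil. Qed.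

Lemma tmax_node l a r : tmax (Node l a r) = maxn (tmax l) (maxn a (tmax r)).
Proof. by rewrite /tmax /= big_cat big_cons. Qed.

Lemma left_max_treeE l a r : left_max_tree (Node l a r) =
  [&& left_max_tree l, left_max_tree r, tmax l < a & tmax r <= a].
Proof.
rewrite /left_max_tree /= geq_max.
case: (ltnP (tmax l) a) => [/ltnW -> | _]; last by rewrite !andbF.
by case: (decreasing l); case: (decreasing r); case: (left_strict l);
  case: (left_strict r); case: (tmax r <= a).
Qed.

Lemma size_labels t : size (labels t) = Defs.tsize t.
Proof. by elim: t => //= l IHl a r IHr; rewrite size_cat /= IHl IHr addnS. Qed.

Lemma labels_insert_right t a : labels (insert_right t a) = rcons (labels t) a.
Proof.
elim: t => //= l _ b r IHr; case: ifP => _ /=; first by rewrite -cats1.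
by rewrite IHr rcons_cat.
Qed.

Lemma tmax_insert_right t a : tmax (insert_right t a) = maxn (tmax t) a.
Proof. by rewrite /tmax labels_insert_right -cats1 big_cat big_seq1. Qed.

(** Positivity of [a] serves the new leaf: its empty left subtree has [tmax] 0, which must lie
    strictly below [a]. *)
Lemma left_max_insert_right t a :
  0 < a -> left_max_tree t -> left_max_tree (insert_right t a).
Proof.
move=> a0; elim: t => [_ | l _ b r IHr].
  by rewrite left_max_treeE tmax_empty a0.
move=> tlm; move: (tlm); rewrite left_max_treeE => /and4P[llm rlm lb rb] /=.
case: ltnP => ba; rewrite left_max_treeE.
  rewrite tlm tmax_empty tmax_node !gtn_max ba (ltn_trans lb ba).
  by rewrite (leq_ltn_trans rb ba) leq0n.
by rewrite llm IHr // lb tmax_insert_right geq_max rb ba.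
Qed.

Lemma labels_cartesian_tree s : labels (cartesian_tree s) = s.
Proof.
elim/last_ind: s => // s a IHs.
by rewrite /cartesian_tree foldl_rcons labels_insert_right IHs.
Qed.

Lemma left_max_cartesian_tree s :
  all (leq 1) s -> left_max_tree (cartesian_tree s).
Proof.
elim/last_ind: s => // s a IHs; rewrite all_rcons => /andP[a0 /IHs].
by rewrite /cartesian_tree foldl_rcons; apply: left_max_insert_right.
Qed.

Lemma insert_right_gt t a : tmax t < a -> insert_right t a = Node t a Defs.Empty.
Proof.
case: t => // l b r; rewrite tmax_node !gtn_max => /and3P[_ ba _] /=.
by rewrite ba.
Qed.

Lemma foldl_insert_right_le l a r s : {in s, forall b, b <= a} ->
  foldl insert_right (Node l a r) s = Node l a (foldl insert_right r s).
Proof.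
elim: s r => // b s IHs r sa /=.
rewrite ltnNge sa ?mem_head //=; apply: IHs => c cs.
by apply: sa; rewrite inE cs orbT.
Qed.

(** By induction, reading [labels l] rebuilds [l]; then [a], exceeding every label of [l], becomes
    the root above it; the letters of [r] never exceed [a], so they all pass to the right of [a] and
    rebuild [r] there. *)
Lemma cartesian_tree_labels t :
  left_max_tree t -> cartesian_tree (labels t) = t.
Proof.
rewrite /cartesian_tree; elim: t => // l IHl a r IHr.
rewrite left_max_treeE => /and4P[/IHl El /IHr Er la /tmax_leqP ra] /=.
by rewrite foldl_cat El /= insert_right_gt // foldl_insert_right_le // Er.
Qed.

Section FunctionsAsTrees.
Variable n : nat.
Implicit Type x : {ffun 'I_n -> 'I_n}.

Definition word x : seq nat := [seq (x i).+1 | i <- enum 'I_n].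

Definition tree_of x : lbtree := cartesian_tree (word x).

Lemma labels_tree_of x : labels (tree_of x) = word x.
Proof. exact: labels_cartesian_tree. Qed.

Lemma word_inj : injective word.
Proof.
move=> x y /eq_in_map xy; apply/ffunP => i; apply/val_inj.
by case: (xy i (mem_enum _ _)).
Qed.

Lemma tree_of_inj : injective tree_of.
Proof. by move=> x y xy; apply: word_inj; rewrite -!labels_tree_of xy. Qed.

Lemma tree_of_endotree x : endotree n (tree_of x).
Proof.
have lm : left_max_tree (tree_of x).
  by apply: left_max_cartesian_tree; apply/allP => _ /mapP[i _ ->].
case/andP: lm => dec ls; rewrite /endotree dec ls -size_labels labels_tree_of.
rewrite size_map size_enum_ord eqxx /=.
by apply/allP => _ /mapP[i _ ->] /=.
Qed.

Lemma word_surj (s : seq nat) :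
  size s = n -> all (fun a => 1 <= a <= n) s -> exists x, word x = s.
Proof.
move=> sn /allP sP.
(* The predecessor undoes the shift in [word]; since letters are positive, no letter is lost to
   [0.-1 = 0]. *)
have lt_n (i : 'I_n) : (nth 0 s i).-1 < n.
  have /sP/andP[a0 an] : nth 0 s i \in s by rewrite mem_nth ?sn.
  by rewrite prednK.
exists [ffun i => Ordinal (lt_n i)].
apply: (@eq_from_nth _ 0) => [| i]; rewrite size_map size_enum_ord // => i_n.
rewrite (nth_map (Ordinal i_n)) ?size_enum_ord // ffunE /= nth_enum_ord //.
by rewrite prednK //; have /sP/andP[] : nth 0 s i \in s by rewrite mem_nth ?sn.
Qed.

Lemma tree_of_surj t : endotree n t -> exists x, tree_of x = t.
Proof.
case/and4P => /eqP tn dec ls /word_surj[|x xt]; first by rewrite size_labels.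
by exists x; rewrite /tree_of xt cartesian_tree_labels // /left_max_tree dec.
Qed.

Lemma mem_word x (j : 'I_n) : (j.+1 \in word x) <-> range x j.
Proof.
split=> [/mapP[i _ [/val_inj ->]] | [i _ <-]]; first by exists i.
by apply/mapP; exists i; rewrite ?mem_enum.
Qed.

Lemma regular_tree_of x : regular n (tree_of x) <-> Cay n x.
Proof.
rewrite /regular labels_tree_of.
(* The same [k] works on both sides: the value [j] is the letter [j.+1], and [j < k] is
   [j.+1 <= k]. *)
split=> -[k kn xk]; exists k => //; apply/seteqP; split=> [j | j] /=.
- move=> /mem_word jx; have : [set` word x] j.+1 by [].
  by rewrite xk.
- move=> jk; apply/mem_word; have : [set a | 1 <= a <= k] j.+1 by [].
  by rewrite -xk.
- case/mapP => i _ ->; have : range x (x i) by exists i.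
  by rewrite xk.
(* The letter 0 is excluded by [1 <= a]; the bound [k <= n] makes the predecessor of any other
   letter an element of ['I_n]. *)
- case: j => // j jk; apply/(mem_word x (Ordinal (leq_trans jk kn))).
  by rewrite xk.
Qed.

Lemma image_tree_of_End : tree_of @` End n = Tree n.
Proof.
apply/seteqP; split=> [_ [x _ <-] | t /tree_of_surj[x <-]].
  exact: tree_of_endotree.
by exists x.
Qed.

Lemma image_tree_of_Cay : tree_of @` Cay n = RegTree n.
Proof.
apply/seteqP; split=> [_ [x /regular_tree_of xr <-] | t [/tree_of_surj[x <-]]].
  by split=> //; apply: tree_of_endotree.
by move=> /regular_tree_of xC; exists x.
Qed.

End FunctionsAsTrees.

Theorem corollary2p4 (n : nat) (hn : 1 <= n) :
  (Tree n #= End n) /\ (RegTree n #= Cay n).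
Proof.
(* Both sets of trees are images under the single injection [tree_of], which preserves
   cardinality. *)
rewrite -image_tree_of_End -image_tree_of_Cay.
by split; apply: inj_card_eq => x y _ _; apply: tree_of_inj.
Qed.
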